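(* Let $n\ge1$ and $0\le k\le n-1$ be integers. Define $\mu:\mathcal S_{n,k+1}\to\{\sigma\in\mathcal S_n:\ell(\mathsf{srw}(\sigma))\ge n-k\}$ by $$\mu((\alpha_0,\rho))=\alpha_1\alpha_2\cdots\alpha_{n-k-m-1}\,\alpha_{n-k-1}\alpha_{n-k-2}\cdots\alpha_{n-k-m}\,\rho_1\cdots\rho_{k+1},$$ where $\alpha_0=\{\alpha_1<\cdots<\alpha_{n-k-1}\}$, $\rho=\rho_1\cdots\rho_{k+1}$ and $m=\#\{\alpha\in\alpha_0:\alpha>\rho_1\}$. Then $\mu$ is a bijection satisfying $\mathsf{des}(\mu((\alpha_0,\rho)))=\mathsf{des}((\alpha_0,\rho))$, and its inverse is the map $\nu$ given, for $\sigma=\sigma_1\cdots\sigma_n$, by $\nu(\sigma)=(\{\sigma_1,\dots,\sigma_{n-k-1}\},\sigma_{n-k}\cdots\sigma_n)$.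
   Context: $[n]=\{1,\dots,n\}$. $\mathcal S_{n,k+1}$ is the set of pairs $(\alpha_0,\rho)$ where $\rho=\rho_1\cdots\rho_{k+1}$ is a word of $k+1$ distinct elements of $[n]$ and $\alpha_0=[n]\setminus\{\rho_1,\dots,\rho_{k+1}\}$, with $\mathsf{des}((\alpha_0,\rho))=\#\{j\in[k]:\rho_j>\rho_{j+1}\}+\#\{a\in\alpha_0:a>\rho_1\}$. Permutations in $\mathcal S_n$ are identified with words $\sigma_1\cdots\sigma_n$, and for a word $u=u_1\cdots u_\ell$, $\mathsf{des}(u)=\#\{j\in[\ell-1]:u_j>u_{j+1}\}$. $\ell(u)$ denotes the length of a word. Special reverse wave of a nonempty word $w=w_1\cdots w_\ell$ with distinct positive entries: if $w$ is increasing, $\mathsf{srw}(w)=w$; otherwise let $t$ be minimal with $w_t>w_{t+1}$, set $w_0=0$, let $s$ be maximal with $t\le s\le\ell$ and $w_t>w_{t+1}>\cdots>w_s>w_{t-1}$, and put $\mathsf{srw}(w)=w_1\cdots w_s$. *)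

(* Defs.v *)
From mathcomp Require Import all_boot all_fingroup.

Set Implicit Arguments.
Unset Strict Implicit.
Unset Printing Implicit Defensive.

(** * Words with positive integer letters *)

(** Letters are indexed from 1, and the convention [w_0 = 0] is built in. *)
Definition letter (w : seq nat) (j : nat) : nat := nth 0 (0 :: w) j.

Definition descent (w : seq nat) (j : nat) : bool :=
  letter w j > letter w j.+1.

Definition des (w : seq nat) : nat :=
  count (descent w) (iota 1 (size w).-1).

(** The least [t >= 1] with [w_t > w_(t+1)]; relevant only if [w] is not
    increasing. *)
Definition first_descent (w : seq nat) : nat :=
  (find (descent w) (iota 1 (size w).-1)).+1.

(** [w_t > w_(t+1) > ... > w_s > w_(t-1)] *)
Definition wave_chain (w : seq nat) (t s : nat) : bool :=
  sorted gtn (rcons [seq letter w j | j <- index_iota t s.+1] (letter w t.-1)).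

Definition wave_end (w : seq nat) : nat :=
  let t := first_descent w in
  \max_(t <= s < (size w).+1 | wave_chain w t s) s.

Definition srw (w : seq nat) : seq nat :=
  if sorted ltn w then w else take (wave_end w) w.

(** * Permutations as words

    The set [[n] = {1, ..., n}] is represented by ['I_n], the ordinal [i]
    standing for the integer [i + 1]. *)

Definition nat_word (n : nat) (u : seq 'I_n) : seq nat :=
  [seq (val i).+1 | i <- u].

Definition oneline (n : nat) (s : 'S_n) : n.-tuple 'I_n := [tuple s i | i < n].

Definition perm_word (n : nat) (s : 'S_n) : seq nat := nat_word (oneline s).

Definition perm_of_oneline (n : nat) (w : n.-tuple 'I_n) (uw : uniq w) : 'S_n :=
  perm (elimT (tuple_uniqP w) uw).

Lemma oneline_perm_of (n : nat) (w : n.-tuple 'I_n) (uw : uniq w) :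
  oneline (perm_of_oneline uw) = w.
Proof. by apply: eq_from_tnth => i; rewrite tnth_mktuple permE. Qed.

Lemma uniq_oneline (n : nat) (s : 'S_n) : uniq (oneline s).
Proof.
by apply/tuple_uniqP => i j; rewrite !tnth_mktuple; apply: perm_inj.
Qed.

Lemma mem_oneline (n : nat) (s : 'S_n) (a : 'I_n) : a \in oneline s.
Proof.
by apply/tnthP; exists (s^-1%g a); rewrite tnth_mktuple permKV.
Qed.

(** * The sets [S_(n,k)] *)

Definition Snk_pred (n k : nat) (x : {set 'I_n} * k.-tuple 'I_n) : bool :=
  uniq x.2 && (x.1 == ~: [set a in x.2]).

Definition Snk (n k : nat) : Type :=
  {x : {set 'I_n} * k.-tuple 'I_n | Snk_pred x}.

Definition alpha0 (n k : nat) (x : Snk n k) : {set 'I_n} := (val x).1.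
Definition rho (n k : nat) (x : Snk n k) : k.-tuple 'I_n := (val x).2.

Definition above (n k : nat) (x : Snk n k.+1) : nat :=
  #|[set a in alpha0 x | thead (rho x) < a]|.

Definition des_pair (n k : nat) (x : Snk n k.+1) : nat :=
  des (nat_word (rho x)) + above x.

(** * The map [mu] *)

(** [enum A] lists a set [A : {set 'I_n}] in increasing order. *)
Definition mu_word (n k : nat) (x : Snk n k.+1) : seq 'I_n :=
  let alpha := enum (alpha0 x) in
  let i := n - k - above x - 1 in
  take i alpha ++ rev (drop i alpha) ++ rho x.

Lemma perm_mu_word (n k : nat) (x : Snk n k.+1) :
  perm_eq (mu_word x) (enum (alpha0 x) ++ rho x).
Proof.
by rewrite /mu_word catA perm_cat2r -[X in perm_eq _ X](cat_take_drop
  (n - k - above x - 1)) perm_cat2l perm_rev.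
Qed.

Lemma uniq_mu_word (n k : nat) (x : Snk n k.+1) : uniq (mu_word x).
Proof.
rewrite (perm_uniq (perm_mu_word x)) cat_uniq enum_uniq /=.
case/andP: (valP x) => -> /eqP Ea; rewrite andbT.
by apply/hasPn => a ax; rewrite mem_enum /alpha0 Ea !inE negbK.
Qed.

Lemma size_mu_word (n k : nat) (x : Snk n k.+1) : size (mu_word x) == n.
Proof.
have /card_uniqP <- := uniq_mu_word x.
rewrite -[X in _ == X]card_ord; apply/eqP/eq_card => a.
rewrite (perm_mem (perm_mu_word x)) mem_cat mem_enum.
by case/andP: (valP x) => _ /eqP Ea; rewrite /alpha0 Ea !inE orNb.
Qed.

Definition mu (n k : nat) (x : Snk n k.+1) : 'S_n :=
  perm_of_oneline (w := Tuple (size_mu_word x)) (uniq_mu_word x).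

(** The codomain of [mu]. *)
Definition long_srw (n k : nat) : {set 'S_n} :=
  [set s : 'S_n | n - k <= size (srw (perm_word s))].

(** * The map [nu] *)

Lemma size_nu_word (n k : nat) (s : 'S_n) :
  k < n -> size (drop (n - k - 1) (oneline s)) == k.+1.
Proof.
by move=> hk; rewrite size_drop size_tuple -subnDA addn1 subKn.
Qed.

Definition nu_pair (n k : nat) (hk : k < n) (s : 'S_n) :
    {set 'I_n} * k.+1.-tuple 'I_n :=
  ([set a in take (n - k - 1) (oneline s)], Tuple (size_nu_word s hk)).

Lemma nu_pairP (n k : nat) (hk : k < n) (s : 'S_n) : Snk_pred (nu_pair hk s).
Proof.
have := uniq_oneline s.
rewrite -{1}(cat_take_drop (n - k - 1) (oneline s)) cat_uniq.
case/and3P=> _ disj ud; rewrite /Snk_pred /= ud /=.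
apply/eqP/setP => a; rewrite !inE memtE /=.
have := mem_oneline s a.
rewrite memtE -{1}(cat_take_drop (n - k - 1) (oneline s)) mem_cat.
case at_: (a \in take _ _); case ad: (a \in drop _ _) => //= _.
by case/hasP: disj; exists a.
Qed.

Definition nu (n k : nat) (hk : k < n) (s : 'S_n) : Snk n k.+1 :=
  exist _ (nu_pair hk s) (nu_pairP hk s).

(* Main.v *)
Require Import Defs.
From mathcomp Require Import all_boot all_fingroup zify.

Set Implicit Arguments.
Unset Strict Implicit.
Unset Printing Implicit Defensive.

(** A word of length greater than [p] has a special reverse wave longer than
    [p] exactly when it can be written [a ++ rev b ++ r :: c] with
    [size a + size b = p] and [a ++ r :: b] increasing.  In this form [a] and
    [b] are the letters before position [p] below and above [r], each listed in
    increasing order, so the set of the first [p] letters together with the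
    suffix [r :: c] determines the word; and its descents are those of [r :: c]
    plus one for each letter of [b]. *)

(** * Letters, descents and decreasing chains *)

Lemma descentS w j : descent w j.+1 = (nth 0 w j.+1 < nth 0 w j).
Proof. by []. Qed.

Lemma letter_cat_size (u v : seq nat) : letter (u ++ v) (size u) = last 0 u.
Proof.
by rewrite /letter -cat_cons nth_cat /= ltnSn -[size u]/(size (0 :: u)).-1 nth_last.
Qed.

Lemma map_letter_iota (u v w : seq nat) :
  [seq letter (u ++ v ++ w) j | j <- iota (size u).+1 (size v)] = v.
Proof.
apply: (@eq_from_nth _ 0); rewrite size_map size_iota // => j jv.
rewrite (nth_map 0) ?size_iota // nth_iota // /letter addSn /=.
by rewrite nth_cat ltnNge leq_addr /= addKn nth_cat jv.
Qed.

(** The chain reads [rev b], then [r], then the last letter of [a], or the conventional 0 if [a] is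
    empty. Reversing it turns decrease into increase. *)
Lemma wave_chain_cat (a b : seq nat) r c :
  wave_chain (a ++ rev b ++ r :: c) (size a).+1 (size a + size b).+1 =
  path ltn (last 0 a) (r :: b).
Proof.
rewrite /wave_chain -[(size a).+1.-1]/(size a) letter_cat_size /index_iota.
have -> : (size a + size b).+2 - (size a).+1 = size (rcons (rev b) r).
  by rewrite size_rcons size_rev; lia.
rewrite -cat_rcons map_letter_iota -rev_cons -rev_cons.
by rewrite rev_sorted.
Qed.

(** The two increasing pieces glue at the last letter of [a]. If [a] is empty, the path starts at 0
    and its first step is [0 < r]. *)
Lemma sorted_wave_form (a b : seq nat) r c : 0 < r ->
  sorted ltn a && wave_chain (a ++ rev b ++ r :: c) (size a).+1
    (size a + size b).+1 = sorted ltn (a ++ r :: b).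
Proof.
by move=> r0; rewrite wave_chain_cat; case: a => [|x a] /=; rewrite ?r0 // cat_path.
Qed.

(** This pointwise form allows a chain to be cut at an earlier end. *)
Lemma wave_chainP (w : seq nat) t s : t <= s ->
  reflect ((forall j, t <= j < s -> descent w j) /\ letter w t.-1 < letter w s)
    (wave_chain w t s).
Proof.
rewrite /wave_chain /index_iota; move: (letter w t.-1) => x ts.
rewrite -(subnKC ts); move: (s - t) => d {s ts}.
have -> : (t + d).+1 - t = d.+1 by lia.
elim: d t => [|d IH] t /=.
  rewrite addn0 andbT; apply: (iffP idP) => [h|[]//]; split=> // j; lia.
apply: (iffP andP) => [[h1 /(IH t.+1)[h2 h3]]|[h1 h2]].
  split; last by rewrite addnS -addSn.
  move=> j; rewrite leq_eqVlt => /andP[/orP[/eqP <- //|tj] js].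
  by apply: h2; rewrite tj; lia.
split; first by apply: h1; lia.
apply/(IH t.+1); rewrite addSn -addnS; split=> // j /andP[tj js].
by apply: h1; lia.
Qed.

Lemma descent_chain_letter w t s :
  (forall j, t <= j < s -> descent w j) ->
  forall s', t <= s' <= s -> letter w s <= letter w s'.
Proof.
move=> h s' /andP[ts s's]; move: (s - s') (subnKC s's) => d sE.
elim: d s' ts {s's} sE => [|d IH] s' ts sE; first by rewrite -sE addn0.
have ds : descent w s' by apply: h; lia.
by apply: leq_trans (IH s'.+1 _ _) (ltnW ds); lia.
Qed.

Lemma uniq_nth_ltnS (w : seq nat) j : uniq w -> j.+1 < size w ->
  (nth 0 w j < nth 0 w j.+1) = ~~ (nth 0 w j.+1 < nth 0 w j).
Proof.
move=> uw jw; rewrite -leqNgt [RHS]leq_eqVlt nth_uniq //; last exact: ltnW.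
by rewrite (ltn_eqF (ltnSn j)).
Qed.

Lemma sorted_take_descentP (w : seq nat) i : uniq w -> i <= size w ->
  reflect (forall j, 0 < j < i -> ~~ descent w j) (sorted ltn (take i w)).
Proof.
move=> uw iw; apply: (iffP (sortedP 0)) => [h [//|j] /andP[_ ji]|h j].
  rewrite descentS -leqNgt; have := h j; rewrite size_takel // !nth_take //; lia.
rewrite size_takel // => ji; rewrite !nth_take //; last lia.
have := h j.+1 ji; rewrite descentS -uniq_nth_ltnS //; lia.
Qed.

(** * The first descent and the length of the special reverse wave *)

Lemma first_descent_min w j : 0 < j < first_descent w -> ~~ descent w j.
Proof.
rewrite /first_descent; set f := find _ _ => /andP[j0 jf].
have fs : f <= (size w).-1.
  by have := find_size (descent w) (iota 1 (size w).-1); rewrite size_iota.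
have := @before_find _ 0 (descent w) (iota 1 (size w).-1) j.-1.
rewrite -/f nth_iota; last lia.
by rewrite add1n prednK // => ->; lia.
Qed.

Lemma first_descent_le w j : 0 < j < size w -> descent w j ->
  first_descent w <= j.
Proof.
move=> /andP[j0 js] dj; rewrite leqNgt; apply/negP => jf.
by have := @first_descent_min w j; rewrite j0 jf dj => /(_ isT).
Qed.

Lemma first_descentP (w : seq nat) : uniq w -> ~~ sorted ltn w ->
  0 < first_descent w < size w /\ descent w (first_descent w).
Proof.
move=> uw; rewrite -{1}(take_size w).
case: (boolP (has (descent w) (iota 1 (size w).-1))) => [hd _|hd].
  have fs := hd; rewrite has_find size_iota in fs.
  have := nth_find 0 hd; rewrite nth_iota // add1n => d; split=> //.
  by rewrite /first_descent; lia.
case/negP; apply/sorted_take_descentP => // j js.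
by apply: (hasPn hd); rewrite mem_iota; lia.
Qed.

Lemma wave_end_ge w s : first_descent w <= s <= size w ->
  wave_chain w (first_descent w) s -> s <= wave_end w.
Proof.
by move=> hs; apply: (leq_bigmax_seq (F := id)); rewrite mem_index_iota ltnS.
Qed.

(** A maximum over no admissible [s] is 0, so a value above [p] comes from an actual chain. *)
Lemma wave_end_gt w p : p < wave_end w ->
  exists2 s, p < s & (first_descent w <= s <= size w) &&
    wave_chain w (first_descent w) s.
Proof.
rewrite /wave_end big_seq_cond; elim/big_ind: _ => [//|x y IHx IHy|s].
  by rewrite leq_max => /orP[/IHx|/IHy].
by rewrite mem_index_iota ltnS => hs ps; exists s.
Qed.

(** The index [i] is [p] when the first [p.+1] letters increase, and otherwise one less than the
    first descent. Asking only for some [i] hides this case distinction. *)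
Lemma srw_gtP (w : seq nat) p : uniq w -> all (ltn 0) w -> p < size w ->
  reflect (exists2 i, i <= p & sorted ltn (take i w) && wave_chain w i.+1 p.+1)
    (p < size (srw w)).
Proof.
move=> uw w0 pw.
have letter_gt0 : 0 < letter w p.+1 by apply/(allP w0)/mem_nth.
have increasing_prefix : sorted ltn (take p.+1 w) ->
    exists2 i, i <= p & sorted ltn (take i w) && wave_chain w i.+1 p.+1.
  move=> /(sorted_take_descentP uw pw) nd; exists p => //; apply/andP; split.
    by apply/sorted_take_descentP => // [|j hj]; [exact: ltnW | apply: nd; lia].
  apply/wave_chainP => //; split=> [j|]; first lia.
  (* The chain is a single letter. For [p = 0] it is compared with the conventional 0, hence the
     positivity. *)
  case: p pw letter_gt0 nd => [//|p] pw _ /(_ p.+1).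
  by rewrite descentS -uniq_nth_ltnS // /letter ltnSn => /(_ isT).
rewrite /srw; case: ifP => [sw|/negbT nsw].
  rewrite pw; apply: ReflectT; apply: increasing_prefix.
  exact: take_sorted.
have [/andP[t0 tw] dt] := first_descentP uw nsw.
set t := first_descent w in t0 tw dt *.
have st i : i <= t -> sorted ltn (take i w).
  move=> it; apply/sorted_take_descentP => // [|j hj]; first lia.
  by apply: first_descent_min; rewrite -/t; lia.
have chain_first : letter w t.-1 < letter w t.
  have : sorted ltn (take t w) by apply: st.
  case: t t0 tw {dt st} => [//|[|t]] _ tw.
    by move=> _; exact: (allP w0 _ (mem_nth 0 (ltnW tw))).
  move/(sortedP 0)/(_ t); rewrite size_takel ?(ltnW tw) // !nth_take //.
  exact.
apply: (iffP idP) => [|[i ip /andP[sti hc]]].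
  rewrite size_take_min leq_min pw andbT.
  case/wave_end_gt=> s ps /andP[/andP[ts sw] hc].
  have [pt|tp] := leqP p.+1 t; first by apply: increasing_prefix; apply: st.
  (* The chain from [t] to [s] is cut at [p.+1]: letters decrease along it, so the one at [p.+1]
     still exceeds the one at [t.-1]. *)
  exists t.-1; first lia.
  rewrite st ?leq_pred // andTb prednK //.
  have [hd hl] := wave_chainP w ts hc.
  apply/wave_chainP; first exact: ltnW.
  split=> [j hj|]; first by apply: hd; rewrite -/t; lia.
  apply: leq_trans hl _; apply: (descent_chain_letter hd).
  by rewrite -/t; lia.
rewrite size_take_min leq_min pw andbT.
have [hd hl] := wave_chainP w (t := i.+1) (s := p.+1) ip hc.
have iw : i <= size w by lia.
have nd := sorted_take_descentP uw iw sti.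
(* A descent before [i] contradicts the increasing prefix. If [t = i], letter [i] exceeds letter
   [i.+1], hence letter [p.+1], against the chain condition. *)
have it : i < t.
  rewrite ltnNge; apply/negP => ti.
  move: ti; rewrite leq_eqVlt => /orP[/eqP tE|ti]; last first.
    by have := nd t; rewrite t0 ti dt => /(_ isT).
  have := @descent_chain_letter w i.+1 p.+1 hd i.+1; move: dt; rewrite tE.
  rewrite /descent; move: hl => /=; lia.
(* If [i = p], the one-letter chain at [t] already ends beyond [p]. Otherwise [i.+1] is a descent,
   so it is the first one. *)
have [ipE|ipN] := eqVneq i p.
  by apply: leq_trans (wave_end_ge (s := t) _ _); rewrite -/t -?ipE //;
    [lia | apply/wave_chainP => //; split=> // j; lia].
have tE : t = i.+1.
  apply/eqP; rewrite eqn_leq it andbT.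
  by apply: first_descent_le; [lia | apply: hd; lia].
by apply: wave_end_ge; rewrite -/t tE; [lia | ].
Qed.

(** * Counting descents *)

Lemma des_cons2 x y w : des [:: x, y & w] = (y < x) + des (y :: w).
Proof.
rewrite /des /= [iota 2 _](iotaDl 1 1) count_map.
(* Index 0 must be excluded: there [letter (y :: w)] gives the conventional 0, not [x]. *)
by congr (_ + _); apply: eq_in_count => -[//|j]; rewrite mem_iota.
Qed.

(** The letter [r] is kept in both factors, so each adjacent pair is counted exactly once. *)
Lemma des_cat (u v : seq nat) r : des (u ++ r :: v) = des (rcons u r) + des (r :: v).
Proof.
elim: u => [//|x [|y u] IH].
  by rewrite [LHS]des_cons2 [des (rcons _ _)]des_cons2 addn0.
by rewrite /= !des_cons2 -addnA -IH.
Qed.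

Lemma des_increasing (u : seq nat) : sorted ltn u -> des u = 0.
Proof.
elim: u => [//|x [//|y u] IH] /andP[xy /IH]; rewrite des_cons2 => ->.
by rewrite ltnNge (ltnW xy).
Qed.

Lemma des_decreasing (u : seq nat) : sorted gtn u -> des u = (size u).-1.
Proof.
elim: u => [//|x [//|y u] IH] /andP[xy /IH]; rewrite des_cons2 => -> /=.
by rewrite (xy : y < x).
Qed.

(** The word ascends through [a] to the largest letter of [b], then descends through [rev b] to [r],
    once per letter of [b]. If [b] is empty, it ascends up to [r]. *)
Lemma des_wave (a b : seq nat) r c : sorted ltn (a ++ r :: b) ->
  des (a ++ rev b ++ r :: c) = size b + des (r :: c).
Proof.
move=> s; rewrite catA des_cat; congr (_ + _).
have srb : sorted gtn (rcons (rev b) r).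
  by rewrite -rev_cons rev_sorted; move: s; rewrite sorted_cat_cons => /andP[].
rewrite rcons_cat.
case E: (rev b) srb => [|y l] srb.
  have -> : b = [::] by apply: (can_inj revK); rewrite E.
  apply: des_increasing; move: s; rewrite sorted_cat_cons => /andP[+ _].
  by rewrite cats1.
have yb : y \in b by rewrite -mem_rev E mem_head.
rewrite des_cat des_increasing; last first.
  apply: (subseq_sorted ltn_trans _ s).
  rewrite -cats1 cat_subseq // sub1seq in_cons yb orbT //.
by rewrite [des _](des_decreasing srb) /= size_rcons -[size b]size_rev E.
Qed.

(** * Increasing words of ordinals *)

Definition ltI n : rel 'I_n := fun i j => i < j.

Lemma ltI_trans n : transitive (@ltI n).
Proof. by move=> j i l; apply: ltn_trans. Qed.

Lemma sorted_nat_word n (u : seq 'I_n) : sorted ltn (nat_word u) = sorted (@ltI n) u.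
Proof. by rewrite sorted_map. Qed.

Lemma nat_word_pos n (u : seq 'I_n) : all (ltn 0) (nat_word u).
Proof. by apply/allP => _ /mapP[i _ ->]. Qed.

Lemma uniq_nat_word n (u : seq 'I_n) : uniq (nat_word u) = uniq u.
Proof. by apply: map_inj_uniq => i j [] /val_inj. Qed.

Lemma sorted_enum n (A : {set 'I_n}) : sorted (@ltI n) (enum A).
Proof.
rewrite {1}/enum_mem -enumT; apply: sorted_filter; first exact: ltI_trans.
by have := iota_ltn_sorted 0 n; rewrite -val_enum_ord sorted_map.
Qed.

Lemma sorted_split n (s : seq 'I_n) (r : 'I_n) : sorted (@ltI n) s ->
  sorted (@ltI n) ([seq i : 'I_n <- s | i < r] ++ r :: [seq i : 'I_n <- s | r < i]).
Proof.
have tr := @ltI_trans n; rewrite !sorted_pairwise // => ps.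
rewrite pairwise_cat /= !pairwise_filter // filter_all !andbT.
apply/allrelP => i j; rewrite mem_filter inE mem_filter => /andP[ir _].
by case/orP=> [/eqP -> //|/andP[rj _]]; apply: ltn_trans rj.
Qed.

(** * Splitting [alpha0] around the first letter of [rho] *)

Section SortedDecomposition.

Variables (n k : nat) (x : Snk n k.+1) (a b : seq 'I_n).
Hypothesis alpha0E : alpha0 x =i a ++ b.
Hypothesis sorted_ab : sorted (@ltI n) (a ++ thead (rho x) :: b).

(** An increasing word is determined by its set of letters. *)
Lemma enum_alpha0 : enum (alpha0 x) = a ++ b.
Proof.
apply: (irr_sorted_eq (@ltI_trans n)) => [i|||i]; first exact: ltnn.
- exact: sorted_enum.
- apply: (subseq_sorted (@ltI_trans n) _ sorted_ab).
  by rewrite cat_subseq // subseq_cons.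
- by rewrite mem_enum alpha0E.
Qed.

(** In an increasing word, the letters exceeding [thead (rho x)] are those placed after it. *)
Lemma above_eq : above x = size b.
Proof.
have u : uniq (a ++ b) by rewrite -enum_alpha0 enum_uniq.
rewrite /above cardE; apply: perm_size; apply: uniq_perm.
- exact: enum_uniq.
- by move: u; rewrite cat_uniq => /and3P[].
move=> i; rewrite mem_enum inE alpha0E mem_cat.
have := sorted_ab; rewrite sorted_pairwise; last exact: ltI_trans.
rewrite pairwise_cat /= => /and3P[/allrelP ar _ /andP[/allP br _]].
case ib: (i \in b); first by rewrite orbT; apply: br.
rewrite orbF; apply/negP => /andP[ia].
by rewrite ltnNge ltnW //; apply: ar => //; rewrite mem_head.
Qed.

Lemma size_decomposition : size a + size b + k.+1 = n.
Proof.
rewrite -[RHS](eqP (size_mu_word x)) (perm_size (perm_mu_word x)) enum_alpha0.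
by rewrite !size_cat size_tuple.
Qed.

Lemma mu_word_eq : mu_word x = a ++ rev b ++ rho x.
Proof.
rewrite /mu_word enum_alpha0 above_eq.
(* By the length count, these subtractions never truncate. *)
have -> : n - k - size b - 1 = size a by have := size_decomposition; lia.
by rewrite take_size_cat // drop_size_cat.
Qed.

End SortedDecomposition.

Lemma rho_cons n k (x : Snk n k.+1) :
  rho x = thead (rho x) :: behead (rho x) :> seq 'I_n.
Proof. by rewrite {1}(tuple_eta (rho x)). Qed.

Lemma alpha0_mem n k (x : Snk n k.+1) i :
  (i \in alpha0 x) = (i \notin tval (rho x)).
Proof.
by case/andP: (valP x) => _ /eqP; rewrite /alpha0 => ->; rewrite !inE memtE.
Qed.

Lemma sorted_decomposition n k (x : Snk n k.+1) : exists a b : seq 'I_n,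
  alpha0 x =i a ++ b /\ sorted (@ltI n) (a ++ thead (rho x) :: b).
Proof.
set r := thead (rho x).
exists [seq i : 'I_n <- enum (alpha0 x) | i < r], [seq i : 'I_n <- enum (alpha0 x) | r < i].
split; last exact/sorted_split/sorted_enum.
move=> i; rewrite mem_cat mem_filter mem_enum mem_filter mem_enum -andb_orl -neq_ltn.
case ia: (i \in alpha0 x); last by rewrite andbF.
rewrite andbT; apply/esym/eqP => /val_inj ir.
by move: ia; rewrite alpha0_mem ir rho_cons mem_head.
Qed.

(** The set component is the complement of the letters of [rho], so [muK] need only compare
    suffixes. *)
Lemma Snk_inj n k (x y : Snk n k.+1) : rho x = rho y :> seq 'I_n -> x = y.
Proof.
move=> rxy; apply: val_inj; case Ex: (val x) => [A u]; case Ey: (val y) => [B v].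
have uv : u = v by apply: val_inj; move: rxy; rewrite /rho Ex Ey.
congr pair => //.
case/andP: (valP x) (valP y) => _ /eqP + /andP[_ /eqP].
by rewrite Ex Ey /= uv => -> ->.
Qed.

(** * The maps [mu] and [nu] *)

Lemma perm_word_mu n k (x : Snk n k.+1) : perm_word (mu x) = nat_word (mu_word x).
Proof. by rewrite /perm_word oneline_perm_of. Qed.

Lemma oneline_inj n : injective (@oneline n).
Proof.
move=> s t st; apply/permP => i.
by have := congr1 (fun w => tnth w i) st; rewrite !tnth_mktuple.
Qed.

Lemma nat_word_wave n (a b c : seq 'I_n) (r : 'I_n) :
  nat_word (a ++ rev b ++ r :: c) =
  nat_word a ++ rev (nat_word b) ++ r.+1 :: nat_word c.
Proof. by rewrite /nat_word !map_cat map_rev. Qed.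

Lemma sorted_nat_word_wave n (a b : seq 'I_n) (r : 'I_n) :
  sorted ltn (nat_word a ++ r.+1 :: nat_word b) = sorted (@ltI n) (a ++ r :: b).
Proof. by rewrite -sorted_nat_word /nat_word map_cat. Qed.

Lemma mu_long n k (x : Snk n k.+1) : k < n -> mu x \in long_srw n k.
Proof.
move=> hk; have [a [b [ab sab]]] := sorted_decomposition x.
have szab := size_decomposition ab sab; rewrite inE perm_word_mu.
have -> : n - k = (size a + size b).+1 by lia.
apply/srw_gtP; rewrite ?uniq_nat_word ?uniq_mu_word ?nat_word_pos //.
  by rewrite size_map (eqP (size_mu_word x)); lia.
(* The reversed block starts right after [a]. *)
exists (size a); first exact: leq_addr.
rewrite (mu_word_eq ab sab) rho_cons nat_word_wave.
rewrite take_size_cat ?size_map // -[size a](size_map (fun i : 'I_n => i.+1)).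
rewrite -[size b](size_map (fun i : 'I_n => i.+1)) sorted_wave_form //.
by rewrite sorted_nat_word_wave.
Qed.

Lemma mu_des n k (x : Snk n k.+1) : des (perm_word (mu x)) = des_pair x.
Proof.
have [a [b [ab sab]]] := sorted_decomposition x.
rewrite perm_word_mu (mu_word_eq ab sab) /des_pair (above_eq ab sab) rho_cons.
by rewrite nat_word_wave des_wave ?sorted_nat_word_wave // size_map addnC.
Qed.

Lemma muK n k (hk : k < n) : cancel (@mu n k) (nu hk).
Proof.
move=> x; apply: Snk_inj.
rewrite -[LHS]/(drop (n - k - 1) (oneline (mu x))) oneline_perm_of.
rewrite -[tval _]/(mu_word x).
have [a [b [ab sab]]] := sorted_decomposition x.
rewrite (mu_word_eq ab sab) catA; apply: drop_size_cat.
by rewrite size_cat size_rev; have := size_decomposition ab sab; lia.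
Qed.

Lemma nuK n k (hk : k < n) : {in long_srw n k, cancel (nu hk) (@mu n k)}.
Proof.
move=> s; rewrite inE => sl; apply: oneline_inj; rewrite oneline_perm_of.
apply: val_inj => /=; set p := n - k - 1.
have pn : p < n by rewrite /p; lia.
have szu : size (oneline s) = n by rewrite size_tuple.
have /srw_gtP[] : p < size (srw (perm_word s)) by move: sl; rewrite /p; lia.
- by rewrite uniq_nat_word uniq_oneline.
- exact: nat_word_pos.
- by rewrite size_map szu.
move=> i ip; set u : seq 'I_n := oneline s in szu *.
pose x := nu hk s.
have rhoE : rho x = drop p u :> seq 'I_n by [].
(* The criterion makes [a ++ thead (rho x) :: b] increasing, so this is the sorted decomposition of
   [nu hk s], and [mu] restores the word from it. *)
pose a := take i u; pose b := rev (drop i (take p u)).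
have take_ab : take p u = a ++ rev b.
  by rewrite revK /a -(take_takel u ip) cat_take_drop.
have uE : u = a ++ rev b ++ thead (rho x) :: behead (rho x).
  by rewrite catA -take_ab -rho_cons rhoE cat_take_drop.
have sza : size a = i by rewrite size_takel // szu; lia.
have szb : size a + size b = p.
  by rewrite -[size b]size_rev -size_cat -take_ab size_takel // szu ltnW.
rewrite /perm_word -/u /nat_word -map_take -/(nat_word _) -/(nat_word _) -/a.
rewrite uE nat_word_wave -sza -szb -[size a](size_map (fun j : 'I_n => j.+1)).
rewrite -[size b](size_map (fun j : 'I_n => j.+1)) sorted_wave_form //.
rewrite sorted_nat_word_wave => sab.
have ab : alpha0 x =i a ++ b.
  by move=> j; rewrite inE -/p -/u take_ab !mem_cat mem_rev.
by rewrite (mu_word_eq ab sab) [RHS]uE -rho_cons.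
Qed.

Theorem theorem5p1 (n k : nat) (hn : 1 <= n) (hk : k < n) :
  [/\ forall x : Snk n k.+1, mu x \in long_srw n k,
      {on long_srw n k, bijective (@mu n k)},
      forall x : Snk n k.+1, des (perm_word (mu x)) = des_pair x,
      cancel (@mu n k) (nu hk)
    & {in long_srw n k, cancel (nu hk) (@mu n k)}].
Proof.
split.
- by move=> x; apply: mu_long.
- by exists (nu hk) => [x _|]; [apply: muK | apply: nuK].
- exact: mu_des.
- exact: muK.
- exact: nuK.
Qed.
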